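(* Let $X$ be a pure $d$-dimensional simplicial complex with a probability distribution $\mu$ on $X(d)$ with $\mu(\sigma)>0$ for all facets, suppose $(X,\mu)$ is connected, let $\boldsymbol\pi$ be a commutative family of maps, $p_\sigma$ the associated polynomials and $\mathcal{C}_\sigma$ the associated cones. If $\mathcal{C}_\emptyset$ is non-empty and, for every $\sigma\in X$ with $|\sigma|=d-2$, the Hessian of the quadratic $p_\sigma$ has at most one positive eigenvalue, then $p_\sigma$ is $\mathcal{C}_\sigma$-Lorentzian for all $\sigma\in X$.
   Context: $X(i)$ = faces of size $i$; link $X_\sigma=\{\tau\setminus\sigma:\tau\in X,\tau\supseteq\sigma\}$, so $X_\sigma(1)$ is the set of vertices $F\notin\sigma$ with $\sigma\cup\{F\}\in X$. $(X,\mu)$ is connected if for every $\sigma$ with $|\sigma|\le d-2$ the graph with vertex set $X_\sigma(1)$ and edge set $X_\sigma(2)$ is connected. A family $\boldsymbol\pi=\{\pi_{\sigma+\tau}:\mathbb{R}^{X_\sigma(1)}\to\mathbb{R}^{X_{\sigma\cup\tau}(1)}\}_{\sigma\in X,\tau\in X_\sigma}$ consists of linear maps of the form $\pi_{\sigma+\tau}(t)_H=t_H-L_{\sigma,\tau,H}((t_F)_{F\in\tau})$ for $H\in X_{\sigma\cup\tau}(1)$, with $L_{\sigma,\tau,H}$ a linear functional; write $\pi_{\sigma+F}=\pi_{\sigma+\{F\}}$. It is commutative if $\pi_{\sigma+(\tau\cup\omega)}=\pi_{(\sigma\cup\tau)+\omega}\circ\pi_{\sigma+\tau}$ for all $\sigma\in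 X$, $\tau\in X_\sigma$, $\omega\in X_{\sigma\cup\tau}$. Polynomials $p_\sigma$ on $\mathbb{R}^{X_\sigma(1)}$ are defined inductively: $p_\sigma=\mu(\sigma)$ for facets, and for $|\sigma|<d$, $(d-|\sigma|)p_\sigma(t)=\sum_{F\in X_\sigma(1)}t_F\,p_{\sigma\cup\{F\}}(\pi_{\sigma+F}(t))$. The cone $\mathcal{C}_\sigma$ is the set of $v\in\mathbb{R}^{X_\sigma(1)}_{>0}$ with $\pi_{\sigma+\tau}(v)\in\mathbb{R}^{X_{\sigma\cup\tau}(1)}_{>0}$ for all $\tau\in X_\sigma$. For $v\in\mathbb{R}^n$, $\nabla_v p=\sum_i v_i\partial_{t_i}p$. For a non-empty open convex cone $\mathcal{C}\subseteq\mathbb{R}^n$, a homogeneous polynomial $p$ of degree $m\ge2$ is $\mathcal{C}$-Lorentzian if (P) $\nabla_{v_1}\cdots\nabla_{v_m}p>0$ for all $v_1,\dots,v_m\in\mathcal{C}$ and (Q) the Hessian of $\nabla_{v_1}\cdots\nabla_{v_{m-2}}p$ has at most one positive eigenvalue for all $v_1,\dots,v_{m-2}\in\mathcal{C}$; a linear form is $\mathcal{C}$-Lorentzian if (P) holds, and a constant if it is positive. *)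

(* Defs.v *)
From HB Require Import structures.
From mathcomp Require Import all_boot all_order all_algebra.
From mathcomp Require Import classical_sets reals.
From mathcomp Require Import mpoly.
(* The notations of MathComp-Analysis are incompatible with those of mpoly. *)
From mathcomp Require Import -(notations) topology normedtype convex.
Import numFieldNormedType.Exports.
(* Imported again so that set0 and the like denote finite sets. *)
From mathcomp Require Import finset.

Set Implicit Arguments.
Unset Strict Implicit.
Unset Printing Implicit Defensive.

Import Order.TTheory GRing.Theory Num.Theory.
Local Open Scope ring_scope.

(** * Polynomials on R^n *)

Definition nabla (R : realType) (n : nat) (v : 'rV[R]_n) (p : {mpoly R[n]}) :
    {mpoly R[n]} :=
  \sum_(i < n) v 0 i *: p^`M(i).

Definition nablas (R : realType) (n : nat) (vs : seq 'rV[R]_n)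
    (p : {mpoly R[n]}) : {mpoly R[n]} :=
  foldr (@nabla R n) p vs.

Definition hessian (R : realType) (n : nat) (p : {mpoly R[n]}) (x : 'rV[R]_n) :
    'M[R]_n :=
  \matrix_(i, j) (p^`M(i)^`M(j)).@[x 0].

(* Eigenvalues are counted with multiplicity. *)
Definition at_most_one_pos_eigenvalue (R : realType) (n : nat) (A : 'M[R]_n) :
    Prop :=
  (forall a b : R, 0 < a -> 0 < b ->
     eigenvalue A a -> eigenvalue A b -> a = b) /\
  (forall a : R, 0 < a -> (mup a (char_poly A) <= 1)%N).

Definition open_convex_cone (R : realType) (n : nat) (C : set 'rV[R]_n) :
    Prop :=
  [/\ open C,
      convex_set (C : set (convex_lmodType 'rV[R]_n)) &
      forall (a : R) (v : 'rV[R]_n), 0 < a -> C v -> C (a *: v)].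

(* [m] is the degree of [p]. The polynomial in (P) is a constant and the
   Hessian in (Q) does not depend on the point, so quantifying over [x] only
   turns them into a scalar and a real matrix. For [m] = 0, (P) says that the
   constant [p] is positive; (Q) is vacuous for [m] < 2. *)
Definition lorentzian (R : realType) (n m : nat) (C : set 'rV[R]_n)
    (p : {mpoly R[n]}) : Prop :=
  [/\ (exists v, C v) /\ open_convex_cone C,
      p \is m.-homog,
      (forall vs : seq 'rV[R]_n, size vs = m -> (forall v, v \in vs -> C v) ->
         forall x : 'rV[R]_n, 0 < (nablas vs p).@[x 0]) &
      forall vs : seq 'rV[R]_n, (size vs).+2 = m ->
        (forall v, v \in vs -> C v) ->
        forall x : 'rV[R]_n,
          at_most_one_pos_eigenvalue (hessian (nablas vs p) x)].

(* The polynomial t |-> p (f t). *)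
Definition comp_lin (R : realType) (n m : nat)
    (f : {linear 'rV[R]_n -> 'rV[R]_m}) (p : {mpoly R[m]}) : {mpoly R[n]} :=
  p \mPo [tuple \sum_(i < n) lin1_mx f i j *: 'X_i | j < m].

(** * Simplicial complexes *)

Definition simplicial_complex (V : finType) (X : {set {set V}}) : Prop :=
  set0 \in X /\
  forall s t : {set V}, s \in X -> t \subset s -> t \in X.

Definition faces (V : finType) (X : {set {set V}}) (i : nat) : {set {set V}} :=
  [set s in X | #|s| == i].

(* The dimension is the common number of vertices of the facets. *)
Definition pure (V : finType) (X : {set {set V}}) (d : nat) : Prop :=
  forall s : {set V}, maxset (fun u => u \in X) s -> #|s| = d.

Definition link (V : finType) (X : {set {set V}}) (s : {set V}) :
    {set {set V}} :=
  [set t :\: s | t in [set t in X | s \subset t]].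

Definition lverts (V : finType) (X : {set {set V}}) (s : {set V}) : {set V} :=
  [set F | (F \notin s) && (s :|: [set F] \in X)].

Definition link_edge (V : finType) (X : {set {set V}}) (s : {set V}) : rel V :=
  fun F G => [set F; G] \in faces (link X s) 2.

Definition connected_complex (V : finType) (X : {set {set V}}) (d : nat) :
    Prop :=
  forall s : {set V}, s \in X -> (#|s|.+2 <= d)%N ->
  {in lverts X s &, forall F G : V, connect (link_edge X s) F G}.

Definition positive_distribution (R : realType) (V : finType)
    (X : {set {set V}}) (d : nat) (mu : {set V} -> R) : Prop :=
  {in faces X d, forall s, 0 < mu s} /\ \sum_(s in faces X d) mu s = 1.

(** * Families of maps *)

(* For a set of vertices A, the space R^A is 'rV[R]_#|A|, the i-th coordinate
   being the one indexed by the vertex enum_val i. *)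

(* The coordinate t_F of t, when F is in A. *)
Definition coord_at (R : realType) (V : finType) (A : {set V})
    (t : 'rV[R]_#|A|) (F : V) : R :=
  \sum_(i < #|A| | enum_val i == F) t 0 i.

Definition subvect (R : realType) (V : finType) (A B : {set V})
    (t : 'rV[R]_#|A|) : 'rV[R]_#|B| :=
  \row_(i < #|B|) coord_at t (enum_val i).

(* Only the values at s in X and t in link X s are relevant. *)
Definition map_family (R : realType) (V : finType) (X : {set {set V}}) : Type :=
  forall s t : {set V},
    {linear 'rV[R]_#|lverts X s| -> 'rV[R]_#|lverts X (s :|: t)|}.

Definition is_map_family (R : realType) (V : finType) (X : {set {set V}})
    (pi : map_family R X) : Prop :=
  forall s t : {set V}, s \in X -> t \in link X s ->
  forall H : V, H \in lverts X (s :|: t) ->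
  exists L : {scalar 'rV[R]_#|t|},
  forall x : 'rV[R]_#|lverts X s|,
    coord_at (pi s t x) H = coord_at x H - L (subvect t x).

(* Equality of the maps is stated coordinatewise because the sets
   s :|: (t :|: w) and (s :|: t) :|: w are not convertible. *)
Definition commutative_family (R : realType) (V : finType) (X : {set {set V}})
    (pi : map_family R X) : Prop :=
  forall s t w : {set V}, s \in X -> t \in link X s -> w \in link X (s :|: t) ->
  forall (x : 'rV[R]_#|lverts X s|) (H : V),
  H \in lverts X (s :|: (t :|: w)) ->
    coord_at (pi s (t :|: w) x) H = coord_at (pi (s :|: t) w (pi s t x)) H.

(* [k] is the codimension d - #|s|. *)
Fixpoint assoc_poly_rec (R : realType) (V : finType) (X : {set {set V}})
    (mu : {set V} -> R) (pi : map_family R X) (k : nat) (s : {set V}) :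
    {mpoly R[#|lverts X s|]} :=
  match k with
  | 0 => (mu s)%:MP
  | k'.+1 =>
      k'.+1%:R^-1 *:
      \sum_(i < #|lverts X s|)
        'X_i * comp_lin (pi s [set enum_val i])
                 (assoc_poly_rec mu pi k' (s :|: [set enum_val i]))
  end.

Definition assoc_poly (R : realType) (V : finType) (X : {set {set V}})
    (d : nat) (mu : {set V} -> R) (pi : map_family R X) (s : {set V}) :
    {mpoly R[#|lverts X s|]} :=
  assoc_poly_rec mu pi (d - #|s|) s.

Definition assoc_cone (R : realType) (V : finType) (X : {set {set V}})
    (pi : map_family R X) (s : {set V}) : set 'rV[R]_#|lverts X s| :=
  fun v => (forall i, 0 < v 0 i) /\
           (forall t, t \in link X s -> forall j, 0 < pi s t v 0 j).

Arguments assoc_cone {R V X} pi s v.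

(* Main.v *)
Require Import Defs.
From HB Require Import structures.
From mathcomp Require Import all_boot all_order all_algebra.
From mathcomp Require Import complex ring lra.
From mathcomp Require Import classical_sets reals.
From mathcomp Require Import mpoly.
From mathcomp Require Import -(notations) topology normedtype convex.
Import numFieldNormedType.Exports.
From mathcomp Require Import finset.

(** Commutativity of the family makes the second derivatives symmetric, so that
Euler's identity gives [∂_F p_σ = p_{σ∪F} ∘ π_{σ+F}], and the polar form of
[p_σ] expands recursively over the links. Positivity (P) follows at once.

For (Q), let [A] be the Hessian of [∇_{v_1} ... ∇_{v_{m-2}} p_σ] and [w = v_1].
The reverse Cauchy-Schwarz inequality for the links, summed with weights [w_F],
gives [A <= A D A] where [D = diag (w_F / (A w)_F)]. The off-diagonal entries of
[A] are nonnegative and, by connectedness of the link, irreducible, so that the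
Laplacian [L = D^-1 - A] is positive semidefinite with kernel spanned by [w].
Then [L <= L D L], and a Cauchy-Schwarz argument for [L] shows that [A] is
negative semidefinite on the orthogonal of [A w]. *)

Set Implicit Arguments.
Unset Strict Implicit.
Unset Printing Implicit Defensive.

Import Order.TTheory GRing.Theory Num.Theory.
Local Open Scope ring_scope.

(** * Bilinear forms with at most one positive direction *)

Section BilinearForms.
Variables (R : rcfType) (n : nat).
Implicit Types (A : 'M[R]_n) (u v w x y z : 'rV[R]_n).

Definition bform A u v : R := (u *m A *m v^T) 0 0.

(** For symmetric matrices this amounts to having at most one positive eigenvalue. Being pointwise,
    it can be evaluated at images of vectors under the maps of the family. *)
Definition reverse_cauchy_schwarz A : Prop :=
  forall u v, 0 < bform A v v -> bform A u u * bform A v v <= bform A u v ^+ 2.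

Lemma bformE A u v : bform A u v = \sum_i (u *m A) 0 i * v 0 i.
Proof. by rewrite /bform mxE; apply: eq_bigr => i _; rewrite !mxE. Qed.

Lemma bformDl A u v w : bform A (u + v) w = bform A u w + bform A v w.
Proof. by rewrite /bform !mulmxDl mxE. Qed.

Lemma bformDr A u v w : bform A u (v + w) = bform A u v + bform A u w.
Proof. by rewrite /bform linearD mulmxDr mxE. Qed.

Lemma bformZl A a u v : bform A (a *: u) v = a * bform A u v.
Proof. by rewrite /bform -!scalemxAl mxE. Qed.

Lemma bformZr A a u v : bform A u (a *: v) = a * bform A u v.
Proof. by rewrite /bform linearZ -scalemxAr mxE. Qed.

Lemma bformC A u v : A^T = A -> bform A u v = bform A v u.
Proof.
move=> sA; rewrite /bform -[in LHS](trmxK (u *m A *m v^T)) mxE.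
by rewrite !trmx_mul trmxK sA mulmxA.
Qed.

Definition bform_lin := (bformDl, bformDr, bformZl, bformZr).

Lemma bform_combo A u v a b : A^T = A ->
  bform A (a *: u + b *: v) (a *: u + b *: v) =
  a ^+ 2 * bform A u u + 2 * a * b * bform A u v + b ^+ 2 * bform A v v.
Proof. by move=> sA; rewrite !bform_lin (bformC v u sA); ring. Qed.

(* A positive definite plane would meet the hyperplane orthogonal to [w]. *)
Lemma reverse_cauchy_schwarz_of_witness A w : A^T = A -> 0 < bform A w w ->
  (forall z, bform A z w = 0 -> bform A z z <= 0) -> reverse_cauchy_schwarz A.
Proof.
move=> sA ww orth u v vv; rewrite leNgt; apply/negP => lt_uv.
(* The coefficients make [a *: u + b *: v] orthogonal to [w]. *)
set a := bform A v w; set b := - bform A u w.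
have := orth (a *: u + b *: v).
rewrite bform_combo // !bform_lin.
have -> : a * bform A u w + b * bform A v w = 0 by rewrite /a /b; ring.
move=> /(_ erefl) le0.
(* Multiply by [bform A v v] and complete the square. The second term is a positive multiple of
   [a ^+ 2], so [a] vanishes and [v] itself is orthogonal to [w]. *)
have {}le0 : (b * bform A v v + a * bform A u v) ^+ 2 +
    a ^+ 2 * (bform A u u * bform A v v - bform A u v ^+ 2) <= 0.
  have := mulr_le0_ge0 le0 (ltW vv); apply: le_trans; rewrite le_eqVlt.
  by apply/orP; left; apply/eqP; ring.
have a0 : a = 0.
  apply/eqP.
  have sb := sqr_ge0 (b * bform A v v + a * bform A u v).
  apply: contraTT lt_uv => na; have sa : 0 < a ^+ 2 by rewrite exprn_even_gt0.
  by rewrite -leNgt; nra.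
by have := orth v a0; rewrite leNgt vv.
Qed.

Lemma cauchy_schwarz_psd A u v : A^T = A -> (forall x, 0 <= bform A x x) ->
  bform A u v ^+ 2 <= bform A u u * bform A v v.
Proof.
move=> sA psd; rewrite leNgt; apply/negP => lt_uv.
(* With a, b, c the values at (u, u), (u, v), (v, v), the first two vectors give c(ac - b^2) >= 0
   and a(ac - b^2) >= 0, so a = c = 0 if ac < b^2. The third then gives -2b^2 >= 0. *)
have := psd (bform A v v *: u + (- bform A u v) *: v).
have := psd ((- bform A u v) *: u + bform A u u *: v).
have := psd (1 *: u + (- bform A u v) *: v).
have := psd u; have := psd v; rewrite !bform_combo //.
move: (bform A u v) (bform A u u) (bform A v v) lt_uv.
move=> b a c lt ha hc h1 h2 h3.
have a0 : a = 0 by nra.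
have c0 : c = 0 by nra.
by rewrite a0 c0 in h1 lt; clear -h1 lt; nra.
Qed.


(** The condition on [f] is connectedness of the graph of positive off-diagonal entries; the last
    hypothesis is A <= A D A. The diagonal of [A] may have any sign, since it cancels in the
    Laplacian. *)
Lemma bform_le0_perron A w : A^T = A ->
  (forall i j, i != j -> 0 <= A i j) ->
  (forall i, 0 < w 0 i) -> (forall i, 0 < (w *m A) 0 i) ->
  (forall f : 'I_n -> R, (forall i j, i != j -> 0 < A i j -> f i = f j) ->
     forall i j, f i = f j) ->
  (forall x, bform A x x <=
     \sum_i w 0 i * ((x *m A) 0 i ^+ 2 / (w *m A) 0 i)) ->
  forall z, bform A z w = 0 -> bform A z z <= 0.
Proof.
move=> sA A_ge0 w_gt0 c_gt0 A_conn A_le z zw0.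
(* The diagonal of D^-1, chosen so that [w] lies in the kernel of [L]. *)
pose e := \row_i ((w *m A) 0 i / w 0 i).
have e_gt0 i : 0 < e 0 i by rewrite mxE divr_gt0.
pose E := diag_mx e; pose L := E - A.
have sE : E^T = E by rewrite tr_diag_mx.
have sL : L^T = L by rewrite linearB /= sE sA.
have EE x y : bform E x y = \sum_i e 0 i * x 0 i * y 0 i.
  by rewrite bformE; apply: eq_bigr => i _; rewrite mul_mx_diag mxE; ring.
have LE x y : bform L x y = bform E x y - bform A x y.
  by rewrite /bform mulmxBr mulmxBl !mxE.
have wE : w *m E = w *m A.
  by apply/rowP => i; rewrite mul_mx_diag !mxE mulrC divfK // gt_eqF.
have wL : w *m L = 0 by rewrite mulmxBr wE subrr.
pose g x i := x 0 i / w 0 i.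
have gx x i : x 0 i = g x i * w 0 i by rewrite divfK // gt_eqF.
(* In the coordinates x / w the form [L] is the Dirichlet form of a weighted graph. *)
have lapl x : 2 * bform L x x =
    \sum_i \sum_j A i j * w 0 i * w 0 j * (g x i - g x j) ^+ 2.
  pose h i j := A i j * w 0 i * w 0 j * g x i ^+ 2.
  have -> : \sum_i \sum_j A i j * w 0 i * w 0 j * (g x i - g x j) ^+ 2 =
      \sum_i \sum_j h i j + \sum_i \sum_j h j i
      - 2 * \sum_i \sum_j x 0 i * A i j * x 0 j.
    rewrite mulr_sumr -big_split -sumrB; apply: eq_bigr => i _ /=.
    rewrite mulr_sumr -big_split -sumrB; apply: eq_bigr => j _ /=.
    have Aji : A j i = A i j by rewrite -[in LHS]sA mxE.
    by rewrite /h Aji (gx x i) (gx x j); ring.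
  rewrite [X in _ + X - _]exchange_big /= LE.
  have -> : \sum_i \sum_j x 0 i * A i j * x 0 j = bform A x x.
    rewrite bformE exchange_big; apply: eq_bigr => j _ /=.
    by rewrite mxE mulr_suml.
  suff -> : \sum_i \sum_j h i j = bform E x x by ring.
  rewrite EE; apply: eq_bigr => i _.
  have -> : e 0 i * x 0 i * x 0 i = (w *m A) 0 i * (w 0 i * g x i ^+ 2).
    by rewrite [e 0 i]mxE (gx x i); field; exact: lt0r_neq0.
  rewrite [(w *m A) 0 i]mxE mulr_suml; apply: eq_bigr => j _.
  by rewrite /h (_ : A i j = A j i) ?mulrA; [ring | rewrite -[in LHS]sA mxE].
have lapl_ge0 x i j : 0 <= A i j * w 0 i * w 0 j * (g x i - g x j) ^+ 2.
  case: (eqVneq i j) => [->|ij]; first by rewrite subrr expr0n mulr0.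
  by rewrite mulr_ge0 ?sqr_ge0 // !mulr_ge0 ?A_ge0 // ltW.
have L_ge0 x : 0 <= bform L x x.
  rewrite -(@pmulr_rge0 _ 2) // lapl.
  by apply: sumr_ge0 => i _; apply: sumr_ge0 => j _.
have L_ker x : bform L x x = 0 -> exists a, x = a *: w.
  move=> Lx0; have : \sum_i \sum_j
      A i j * w 0 i * w 0 j * (g x i - g x j) ^+ 2 = 0 by rewrite -lapl Lx0 mulr0.
  move=> /psumr_eq0P g0.
  have {}g0 i : \sum_j A i j * w 0 i * w 0 j * (g x i - g x j) ^+ 2 = 0.
    by apply: g0 => // k _; apply: sumr_ge0 => j _.
  have gE i j : g x i = g x j.
    apply: A_conn => {}i {}j ij Aij; have /psumr_eq0P gi0 := g0 i.
    have /eqP := gi0 (fun k _ => lapl_ge0 x i k) j isT.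
    by rewrite mulf_eq0 sqrf_eq0 gt_eqF ?mulr_gt0 //= subr_eq0 => /eqP.
  case: (pickP (fun _ : 'I_n => true)) => [i0 _|n0]; last first.
    by exists 0; apply/rowP => i; have := n0 i.
  exists (g x i0); apply/rowP => i.
  by rewrite mxE (gE i0 i) divfK // gt_eqF.
(* The rank-one term makes [L] positive definite, hence invertible, by acting on its kernel. *)
pose M := L + w^T *m w.
have M_unit : M \in unitmx.
  rewrite -row_free_unit; apply: inj_row_free => y yM0.
  have yw : bform L y y + (y *m w^T) 0 0 ^+ 2 = 0.
    have := congr1 (fun v => (v *m y^T) 0 0) yM0.
    rewrite mul0mx [RHS]mxE mulmxDr mulmxDl mxE -/(bform L y y) mulmxA => <-.
    congr (_ + _); have wy : w *m y^T = (y *m w^T)^T by rewrite trmx_mul trmxK.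
    by rewrite -(mulmxA (y *m w^T)) wy [RHS]mxE big_ord1 [(_^T) 0 0]mxE expr2.
  have := L_ge0 y; have := sqr_ge0 ((y *m w^T) 0 0) => yw_ge0 Ly_ge0.
  have /L_ker[a ya] : bform L y y = 0 by lra.
  have /eqP : (y *m w^T) 0 0 ^+ 2 = 0 by lra.
  rewrite sqrf_eq0 mxE => /eqP yw0.
  have : \sum_i y 0 i ^+ 2 = 0.
    transitivity (a * \sum_i y 0 i * w^T i 0); last by rewrite yw0 mulr0.
    rewrite mulr_sumr; apply: eq_bigr => i _.
    have yi : y 0 i = a * w 0 i by rewrite {1}ya mxE.
    by rewrite [w^T i 0]mxE expr2 {1}yi; ring.
  move=> /psumr_eq0P y0; apply/rowP => i; rewrite [RHS]mxE; apply/eqP.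
  by rewrite -sqrf_eq0 y0 // => j _; rewrite sqr_ge0.
pose y := z *m E *m invmx M.
have yM : y *m M = z *m E by rewrite mulmxKV.
(* Multiplying [yM] by [w^T] kills both y L and z E, the latter because [z] is orthogonal to w A = w
   E. So [y] is orthogonal to [w] and solves y L = z E. *)
have yw0 : y *m w^T *m w = 0.
  have zE : z *m E *m w^T = 0.
    apply/rowP => i; rewrite ord1 [RHS]mxE -zw0.
    by rewrite -/(bform E z w) (bformC _ _ sE) (bformC _ _ sA) /bform wE.
  have := congr1 (mulmx^~ w^T) yM; rewrite zE mulmxDr mulmxDl.
  have -> : y *m L *m w^T = 0.
    by rewrite -mulmxA -[L *m _]trmxK trmx_mul trmxK sL wL trmx0 mulmx0.
  rewrite add0r mulmxA -mulmxA => yww.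
  apply/rowP => i; rewrite mxE big_ord1 [RHS]mxE; apply/eqP.
  rewrite mulf_eq0 (gt_eqF (w_gt0 i)) orbF.
  have /matrixP/(_ 0 0) := yww; rewrite [LHS]mxE big_ord1 [RHS]mxE => /eqP.
  rewrite mulf_eq0 => /orP[//|]; rewrite gt_eqF // mxE.
  rewrite (bigD1 i) //= mxE ltr_wpDr ?mulr_gt0 //.
  by apply: sumr_ge0 => k _; rewrite mxE mulr_ge0 // ltW.
have yL : y *m L = z *m E by rewrite -yM (mulmxDr y L) mulmxA yw0 addr0.
have Lyz v : bform L y v = bform E z v by rewrite /bform yL.
have yA i : (y *m A) 0 i = e 0 i * (y 0 i - z 0 i).
  have -> : A = E - L by rewrite /L opprB addrC subrK.
  by rewrite mulmxBr yL !mul_mx_diag !mxE; ring.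
(* By [yA] the right-hand side of the hypothesis at [y] is E(y - z, y - z). Now use A = E - L and
   L(y, y) = E(z, y). *)
have yLy : bform L y y <= bform E z z.
  have := A_le y.
  have -> : \sum_i w 0 i * ((y *m A) 0 i ^+ 2 / (w *m A) 0 i) =
      bform E y y - 2 * bform E z y + bform E z z.
    rewrite !EE mulr_sumr -sumrB -big_split; apply: eq_bigr => i _ /=.
    rewrite yA (_ : (w *m A) 0 i = w 0 i * e 0 i); last first.
      by rewrite [e 0 i]mxE mulrC divfK // gt_eqF.
    by field; rewrite !lt0r_neq0.
  by have := LE y y; rewrite Lyz; lra.
(* Cauchy-Schwarz gives E(z, z)^2 <= L(y, y) L(z, z) <= E(z, z) L(z, z), hence E(z, z) <= L(z, z),
   that is, A(z, z) <= 0. *)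
have cs := cauchy_schwarz_psd y z sL L_ge0; rewrite Lyz in cs.
have := LE z z; have Lz := L_ge0 z.
have Ez : 0 <= bform E z z by rewrite (le_trans _ yLy).
suff : bform E z z <= bform L z z by lra.
have {}cs : bform E z z ^+ 2 <= bform E z z * bform L z z.
  by apply: le_trans cs _; rewrite ler_wpM2r.
have [<-//|Ez0] := eqVneq 0 (bform E z z).
by rewrite -(@ler_pM2l _ (bform E z z)) -?expr2 // lt_neqAle Ez0.
Qed.

End BilinearForms.

(** * Signature and eigenvalues of real symmetric matrices *)

(** Over the complex numbers the matrix is Hermitian, so it is diagonalizable with real spectrum; a
    similarity between real matrices can then be realized by a real matrix. *)
Lemma symmetric_diagonalizable (R : rcfType) n (A : 'M[R]_n) : A^T = A ->
  exists (P : 'M[R]_n) (d : 'rV[R]_n),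
    P \in unitmx /\ P *m A = diag_mx d *m P.
Proof.
move=> sA; pose toC := real_complex R.
pose AC := map_mx toC A.
have ReC m k (B : 'M[R[i]]_(m, k)) : B \is a realmx ->
    map_mx toC (map_mx (@complex.Re R) B) = B.
  by move=> /mxOverP Breal; apply/matrixP => i j; rewrite !mxE; apply: RRe_real.
have ACreal : AC \is a realmx.
  by apply/mxOverP => i j; rewrite mxE; apply/complex_realP; exists (A i j).
have ACherm : AC \is hermsymmx.
  apply: realsym_hermsym => //; apply/is_hermitianmxP.
  rewrite expr0 scale1r map_mx_id //; apply/matrixP => i j.
  by rewrite !mxE -[in LHS]sA mxE.
have dreal := hermitian_spectral_diag_real ACherm.
have /orthomx_spectralP ACE := hermitian_normalmx ACherm.
have Uunit := spectral_unit AC.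
have [||P] := @real_similar _ _ AC (diag_mx (spectral_diag AC)) _ ACreal.
- exists (spectralmx AC) => //; apply/similarP => //.
  by rewrite {2}ACE -mulmxA mulKVmx.
- apply/mxOverP => i j; rewrite mxE; case: (i == j); last exact: real0.
  by rewrite mulr1n; apply: (mxOverP dreal).
rewrite inE => /andP[Preal Punit] /(similarP Punit) PA.
exists (map_mx (@complex.Re R) P), (map_mx (@complex.Re R) (spectral_diag AC)).
split; first by rewrite -(map_unitmx toC) ReC.
apply: (@map_mx_inj _ _ toC).
by rewrite !map_mxM map_diag_mx !ReC.
Qed.

Lemma char_poly_diagonalized (R : fieldType) n (P A : 'M[R]_n) (d : 'rV[R]_n) :
  P \in unitmx -> P *m A = diag_mx d *m P ->
  char_poly A = \prod_i ('X - (d 0 i)%:P).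
Proof.
move=> Punit PA.
have -> : \prod_i ('X - (d 0 i)%:P) = char_poly (diag_mx d).
  rewrite char_poly_trig ?diag_mx_is_trig //.
  by apply: eq_bigr => i _; rewrite mxE eqxx mulr1n.
have PC : map_mx polyC P *m char_poly_mx A =
    char_poly_mx (diag_mx d) *m map_mx polyC P.
  by rewrite mulmxBr mulmxBl -!map_mxM PA mul_mx_scalar mul_scalar_mx.
have := congr1 determinant PC; rewrite !det_mulmx mulrC; apply: mulIf.
by rewrite det_map_mx polyC_eq0 -unitfE -unitmxE.
Qed.

Lemma at_most_one_pos_eigenvalueP (R : realType) n (P A : 'M[R]_n)
    (d : 'rV[R]_n) :
  P \in unitmx -> P *m A = diag_mx d *m P ->
  at_most_one_pos_eigenvalue A <->
  (forall i j, 0 < d 0 i -> 0 < d 0 j -> i = j).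
Proof.
move=> Punit PA; have chA := char_poly_diagonalized Punit PA.
have eigA a : eigenvalue A a -> exists i, a = d 0 i.
  rewrite eigenvalue_root_char chA rootE horner_prod => /eqP/eqP.
  rewrite prodf_seq_eq0 => /hasP[i _] /=.
  by rewrite !hornerE subr_eq0 => /eqP ->; exists i.
have eigd i : eigenvalue A (d 0 i).
  by rewrite eigenvalue_root_char chA (bigD1 i) //= rootM root_XsubC eqxx.
split=> [[eqA mupA] i j di dj|eqd].
  apply/eqP/negP => /negP neq_ij.
  (* The first clause makes the two entries equal, and their common value is then a double root. *)
  have dij := eqA _ _ di dj (eigd i) (eigd j).
  have := mupA _ di; rewrite leqNgt mup_geq; last first.
    by rewrite -size_poly_eq0 size_char_poly.
  rewrite chA (bigD1 i) //= (bigD1 j) 1?eq_sym //= -dij mulrA -expr2.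
  by rewrite dvdp_mulr.
split=> [a b a0 b0 /eigA[i ai] /eigA[j bj]|a a0].
  by rewrite ai bj (eqd i j) -?ai -?bj.
have [|rootA] := boolP (root (char_poly A) a); last by rewrite mupNroot.
rewrite -eigenvalue_root_char => /eigA[i ai].
rewrite chA (bigD1 i) //= mupMl.
  by rewrite -[_ - _]expr1 mup_XsubCX; case: eqP.
rewrite rootE horner_prod prodf_seq_neq0; apply/allP => j _.
apply/implyP => neq_ji.
rewrite !hornerE subr_eq0 ai; apply: contraNneq neq_ji => dij.
by rewrite (eqd i j) // -?dij -ai.
Qed.

Section Signature.
Variables (R : realType) (n : nat) (A P : 'M[R]_n) (d : 'rV[R]_n).
Hypotheses (sA : A^T = A) (P_unit : P \in unitmx).
Hypothesis PA : P *m A = diag_mx d *m P.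

(* The rows of [P] are eigenvectors but need not be orthonormal; their Gram
   matrix couples only those with equal eigenvalues. *)
Let G := P *m P^T.

(** Both sides are the (i, j) entry of P A P^T. *)
Let G_comm i j : d 0 i * G i j = d 0 j * G i j.
Proof.
have GD : diag_mx d *m G = G *m diag_mx d.
  rewrite mulmxA -PA /G -mulmxA -[A *m P^T]trmxK trmx_mul trmxK sA.
  by rewrite PA trmx_mul tr_diag_mx mulmxA.
have /matrixP/(_ i j) := GD.
by rewrite mul_diag_mx mul_mx_diag !mxE [_ * d 0 j]mulrC.
Qed.

Let G_gt0 (x : 'rV[R]_n) : x != 0 -> 0 < bform G x x.
Proof.
move=> x0; have -> : bform G x x = \sum_k (x *m P) 0 k ^+ 2.
  rewrite /bform mulmxA -mulmxA -trmx_mul mxE.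
  by apply: eq_bigr => k _; rewrite [(_^T) k 0]mxE expr2.
rewrite lt_neqAle sumr_ge0 ?andbT => [|k _]; last exact: sqr_ge0.
rewrite eq_sym; apply: contra x0 => /eqP/psumr_eq0P xP0.
suff : x *m P = 0.
  by move/(congr1 (mulmx^~ (invmx P))); rewrite mulmxK // mul0mx => ->.
apply/rowP => k; rewrite [RHS]mxE; apply/eqP.
by rewrite -sqrf_eq0 xP0 // => j _; exact: sqr_ge0.
Qed.

Let G_sym : G^T = G.
Proof. by rewrite trmx_mul trmxK. Qed.

Let bformP (x y : 'rV[R]_n) : bform A (x *m P) (y *m P) =
  \sum_i \sum_j d 0 i * (x 0 i * G i j * y 0 j).
Proof.
rewrite /bform trmx_mul -(mulmxA x) PA !mulmxA -(mulmxA _ P) -(mulmxA x).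
rewrite exchange_big mxE; apply: eq_bigr => j _ /=.
rewrite [y^T j 0]mxE mxE mulr_suml; apply: eq_bigr => i _.
by rewrite mul_diag_mx mxE -/G; ring.
Qed.

Let e (i : 'I_n) : 'rV[R]_n := delta_mx 0 i.

Let bform_delta_r i (x : 'rV[R]_n) :
  bform A (x *m P) (e i *m P) = \sum_j d 0 j * (x 0 j * G j i).
Proof.
rewrite bformP; apply: eq_bigr => j _; rewrite (bigD1 i) //= big1 => [|k ki].
  by rewrite [e _ 0 _]mxE !eqxx mulr1 addr0.
by rewrite [e _ 0 _]mxE (negbTE ki) andbF !mulr0.
Qed.

Let bform_delta i j : bform A (e i *m P) (e j *m P) = d 0 i * G i j.
Proof.
rewrite bform_delta_r (bigD1 i) //= big1 => [|k ki].
  by rewrite [e _ 0 _]mxE !eqxx mul1r addr0.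
by rewrite [e _ 0 _]mxE (negbTE ki) andbF mul0r mulr0.
Qed.

Let bformG i j : bform G (e i) (e j) = G i j.
Proof. by rewrite /bform -rowE trmx_delta -colE mxE [LHS]mxE. Qed.

Let e_neq0 i : e i != 0.
Proof. by apply/eqP => /rowP/(_ i)/eqP; rewrite !mxE !eqxx oner_eq0. Qed.

Let bform_le0 (y : 'rV[R]_n) : (forall i, 0 < d 0 i -> y 0 i = 0) ->
  bform A (y *m P) (y *m P) <= 0.
Proof.
(* As [G] couples only indices with equal [d], the factor -d_i splits into one square root for each
   argument. Where d_i > 0 the root defaults to 0, and so does y_i. *)
move=> y0; pose t := \row_i (Num.sqrt (- d 0 i) * y 0 i).
have -> : bform A (y *m P) (y *m P) = - bform G t t.
  rewrite bformP bformE exchange_big -sumrN; apply: eq_bigr => j _ /=.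
  rewrite mxE mulr_suml -sumrN; apply: eq_bigr => i _; rewrite ![t _ _]mxE.
  have [di0|di0] := ltP 0 (d 0 i); first by rewrite y0 //; ring.
  have [Gij|Gij] := eqVneq (G i j) 0; first by rewrite Gij; ring.
  have <- : d 0 i = d 0 j by apply: (mulIf Gij); exact: G_comm.
  have -> : d 0 i = - Num.sqrt (- d 0 i) ^+ 2.
    by rewrite sqr_sqrtr ?opprK // oppr_ge0.
  by rewrite opprK sqrtr_sqr ger0_norm ?sqrtr_ge0 //; ring.
rewrite oppr_le0; have [->|/G_gt0/ltW//] := eqVneq t 0.
by rewrite /bform mul0mx mul0mx mxE.
Qed.

(** Two positive entries would span a positive definite plane, where the strict Cauchy-Schwarz
    inequality holds. Conversely, the eigenvector of the only positive entry is a witness; with no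
    positive entry the claim is vacuous. *)
Lemma reverse_cauchy_schwarz_signature :
  reverse_cauchy_schwarz A <-> (forall i j, 0 < d 0 i -> 0 < d 0 j -> i = j).
Proof.
have Gii i : 0 < G i i by rewrite -bformG G_gt0.
split=> [rcs i j di dj|d_uniq].
  apply/eqP/negP => /negP neq_ij.
  have G_lt : G i j ^+ 2 < G i i * G j j.
    have : 0 < bform G (G j j *: e i + (- G i j) *: e j)
                       (G j j *: e i + (- G i j) *: e j).
      apply: G_gt0; apply/eqP => /rowP/(_ i).
      rewrite [RHS]mxE [LHS]mxE [(_ *: e i) 0 i]mxE [(_ *: e j) 0 i]mxE.
      rewrite ![e _ 0 i]mxE !eqxx (negbTE neq_ij) mulr0 addr0 mulr1 => /eqP.
      by rewrite gt_eqF.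
    rewrite bform_combo // !bformG => pos.
    rewrite -subr_gt0 -(@pmulr_rgt0 _ (G j j)) //.
    apply: lt_le_trans pos _; rewrite le_eqVlt.
    by apply/orP; left; apply/eqP; ring.
  have := rcs (e i *m P) (e j *m P).
  rewrite !bform_delta mulr_gt0 // => /(_ isT).
  rewrite expr2 {2}G_comm => le.
  have dd := mulr_gt0 di dj.
  have : (d 0 i * d 0 j) * (G i i * G j j) <= (d 0 i * d 0 j) * G i j ^+ 2.
    apply: le_trans (le_trans _ le) _; rewrite le_eqVlt;
    by apply/orP; left; apply/eqP; ring.
  by rewrite ler_pM2l // leNgt G_lt.
have PK (x : 'rV[R]_n) : x = (x *m invmx P) *m P by rewrite mulmxKV.
case: (pickP (fun i => 0 < d 0 i)) => [i0 di0|d_le0]; last first.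
  move=> u v; rewrite (PK v) => vv; exfalso; move: vv; apply/negP.
  rewrite -leNgt.
  by apply: bform_le0 => i; rewrite d_le0.
apply: (@reverse_cauchy_schwarz_of_witness _ _ _ (e i0 *m P)) => //.
  by rewrite bform_delta mulr_gt0.
move=> z; rewrite (PK z); set y := z *m invmx P.
rewrite bform_delta_r (bigD1 i0) //= big1 => [|j ji0].
  rewrite addr0 => /eqP; rewrite !mulf_eq0 !(gt_eqF di0, gt_eqF (Gii _)) orbF /=.
  by move=> /eqP y0; apply: bform_le0 => i /(d_uniq i0 i di0) <-.
have [Gji|Gji] := eqVneq (G j i0) 0; first by rewrite Gji !mulr0.
have dj : d 0 j = d 0 i0 by apply: (mulIf Gji); exact: G_comm.
by case/eqP: ji0; apply: d_uniq => //; rewrite dj; exact: di0.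
Qed.

End Signature.

Lemma reverse_cauchy_schwarzP (R : realType) n (A : 'M[R]_n) : A^T = A ->
  reverse_cauchy_schwarz A <-> at_most_one_pos_eigenvalue A.
Proof.
move=> sA; have [P [d [P_unit PA]]] := symmetric_diagonalizable sA.
rewrite (at_most_one_pos_eigenvalueP P_unit PA).
exact: reverse_cauchy_schwarz_signature sA P_unit PA.
Qed.

(** * Directional derivatives and linear substitutions *)

(** Suited to derivations and substitutions, which are determined on constants and variables. *)
Lemma mpoly_ind_ring (R : comNzRingType) n (K : {mpoly R[n]} -> Prop) :
  (forall c, K c%:MP) -> (forall i, K 'X_i) ->
  (forall p q, K p -> K q -> K (p + q)) ->
  (forall p q, K p -> K q -> K (p * q)) -> forall p, K p.
Proof.
move=> KC KX KD KM; elim/mpolyind => [|c m p _ _ Kp]; first by rewrite -mpolyC0.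
apply: (KD) => //; rewrite -mul_mpolyC; apply: (KM) => //.
rewrite mpolyXE_id; apply: big_ind => [||i _]; [by rewrite -mpolyC1|exact: KM|].
by elim: (m i) => [|k IHk]; rewrite ?expr0 -?mpolyC1 // exprS; exact: KM.
Qed.

Section Nabla.
Variables (R : realType) (n : nat).
Implicit Types (p q : {mpoly R[n]}) (u v : 'rV[R]_n).

Lemma nabla_is_linear v : linear (@nabla R n v).
Proof.
move=> c p q; rewrite /nabla scaler_sumr -big_split; apply: eq_bigr => i _ /=.
by rewrite linearP scalerDr !scalerA mulrC.
Qed.
HB.instance Definition _ v := GRing.isLinear.Build R {mpoly R[n]} {mpoly R[n]} _
  (@nabla R n v) (nabla_is_linear v).

Lemma nablaC v c : nabla v c%:MP = 0.
Proof. by rewrite /nabla big1 // => i _; rewrite mderivC scaler0. Qed.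

Lemma nablaX v i : nabla v 'X_i = (v 0 i)%:MP.
Proof.
rewrite /nabla (bigD1 i) //= big1 => [|j ji].
  rewrite mderivX mnm1E eqxx scale1r -mul_mpolyC addr0.
  rewrite (_ : (_ - _)%MM = 0%MM) ?mpolyX0 ?mulr1 //.
  by apply/mnmP => k; rewrite mnmBE mnm0E subnn.
by rewrite mderivX mnm1E eq_sym (negbTE ji) scale0r scaler0.
Qed.

Lemma nablaM v p q : nabla v (p * q) = nabla v p * q + p * nabla v q.
Proof.
rewrite /nabla mulr_suml mulr_sumr -big_split; apply: eq_bigr => i _ /=.
by rewrite mderivM scalerDr scalerAl scalerAr.
Qed.

Lemma nabla_comm u v p : nabla u (nabla v p) = nabla v (nabla u p).
Proof.
have nablaE x y : nabla x (nabla y p) =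
    \sum_i \sum_j (x 0 i * y 0 j) *: p^`M(j)^`M(i).
  rewrite {1}/nabla; apply: eq_bigr => i _.
  rewrite [(nabla y p)^`M(i)]linear_sum scaler_sumr; apply: eq_bigr => j _.
  by rewrite /= mderivZ scalerA.
rewrite !nablaE exchange_big; apply: eq_bigr => i _; apply: eq_bigr => j _ /=.
by rewrite mderiv_comm mulrC.
Qed.

Lemma nabla_delta i p : nabla (delta_mx 0 i) p = p^`M(i).
Proof.
rewrite /nabla (bigD1 i) //= big1 => [|j ji].
  by rewrite mxE !eqxx scale1r addr0.
by rewrite mxE (negbTE ji) andbF scale0r.
Qed.

Lemma nablas_is_linear vs : linear (@nablas R n vs).
Proof. by elim: vs => [|v vs IHvs] c p q //=; rewrite IHvs linearP. Qed.
HB.instance Definition _ vs := GRing.isLinear.Build R {mpoly R[n]} {mpoly R[n]} _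
  (@nablas R n vs) (nablas_is_linear vs).

Lemma nablas_nabla v vs p : nablas vs (nabla v p) = nabla v (nablas vs p).
Proof. by elim: vs => //= u vs ->; rewrite nabla_comm. Qed.

End Nabla.

Section CompLin.
Variable R : realType.

Lemma comp_linM n m (f : {linear 'rV[R]_n -> 'rV[R]_m}) p q :
  comp_lin f (p * q) = comp_lin f p * comp_lin f q.
Proof. exact: rmorphM. Qed.

Lemma comp_lin_is_linear n m (f : {linear 'rV[R]_n -> 'rV[R]_m}) :
  linear (comp_lin f).
Proof. by move=> c p q; rewrite /comp_lin linearP. Qed.
HB.instance Definition _ n m (f : {linear 'rV[R]_n -> 'rV[R]_m}) :=
  GRing.isLinear.Build R {mpoly R[m]} {mpoly R[n]} _
  (comp_lin f) (comp_lin_is_linear f).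

Lemma comp_linC n m (f : {linear 'rV[R]_n -> 'rV[R]_m}) c :
  comp_lin f c%:MP = c%:MP.
Proof. exact: comp_mpolyC. Qed.

Lemma comp_linX n m (f : {linear 'rV[R]_n -> 'rV[R]_m}) j :
  comp_lin f 'X_j = \sum_i f (delta_mx 0 i) 0 j *: 'X_i.
Proof.
rewrite /comp_lin comp_mpolyXU -tnth_nth tnth_mktuple.
by apply: eq_bigr => i _; rewrite !mxE.
Qed.

Lemma linear_row n m (f : {linear 'rV[R]_n -> 'rV[R]_m}) (v : 'rV[R]_n) j :
  f v 0 j = \sum_i v 0 i * f (delta_mx 0 i) 0 j.
Proof.
rewrite {1}[v]row_sum_delta linear_sum summxE.
by apply: eq_bigr => i _; rewrite linearZ mxE.
Qed.

Lemma eval_comp_lin n m (f : {linear 'rV[R]_n -> 'rV[R]_m}) p (x : 'rV[R]_n) :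
  (comp_lin f p).@[x 0] = p.@[f x 0].
Proof.
rewrite /comp_lin comp_mpoly_meval; apply: meval_eq => j.
rewrite tnth_mktuple linear_sum linear_row; apply: eq_bigr => i _.
by rewrite linearZ /= mevalXU mulrC !mxE.
Qed.

Lemma comp_lin_comp n m k (f : {linear 'rV[R]_n -> 'rV[R]_m})
    (g : {linear 'rV[R]_m -> 'rV[R]_k}) (h : {linear 'rV[R]_n -> 'rV[R]_k}) p :
  (forall x, g (f x) = h x) -> comp_lin f (comp_lin g p) = comp_lin h p.
Proof.
move=> gf; elim/mpoly_ind_ring: p => [c|j|p q IHp IHq|p q IHp IHq].
- by rewrite !comp_linC.
- rewrite !comp_linX linear_sum.
  under eq_bigr do rewrite linearZ /= comp_linX scaler_sumr.
  rewrite exchange_big; apply: eq_bigr => i _ /=.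
  rewrite -gf [in RHS]linear_row scaler_suml; apply: eq_bigr => l _.
  by rewrite scalerA mulrC.
- by rewrite !linearD /= IHp IHq.
- by rewrite !comp_linM IHp IHq.
Qed.

Lemma nabla_comp_lin n m (f : {linear 'rV[R]_n -> 'rV[R]_m}) v p :
  nabla v (comp_lin f p) = comp_lin f (nabla (f v) p).
Proof.
elim/mpoly_ind_ring: p => [c|j|p q IHp IHq|p q IHp IHq].
- by rewrite comp_linC !nablaC linear0.
- rewrite nablaX comp_linC comp_linX linear_sum linear_row raddf_sum.
  by apply: eq_bigr => i _; rewrite linearZ /= nablaX -mul_mpolyC -mpolyCM mulrC.
- by rewrite !linearD /= IHp IHq.
- by rewrite comp_linM !nablaM linearD /= !comp_linM IHp IHq.
Qed.

Lemma nablas_comp_lin n m (f : {linear 'rV[R]_n -> 'rV[R]_m}) vs p :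
  nablas vs (comp_lin f p) = comp_lin f (nablas (map f vs) p).
Proof. by elim: vs => //= v vs ->; rewrite nabla_comp_lin. Qed.

Lemma comp_lin_homog n m (f : {linear 'rV[R]_n -> 'rV[R]_m}) d p :
  p \is d.-homog -> comp_lin f p \is d.-homog.
Proof.
move=> hp; rewrite /comp_lin comp_mpolyEX big_seq rpred_sum // => mm.
move=> /(dhomog_mf hp) /= <-; apply: rpredZ; rewrite comp_mpolyX mdegE.
apply: (big_ind2 (fun (q : {mpoly R[n]}) (c : nat) => q \is c.-homog))
  => [|q c q' c'|j _].
- exact: dhomog1.
- exact: dhomogM.
rewrite tnth_mktuple; set q := \sum_(i < n) _.
have hq : q \is 1.-homog.
  apply: rpred_sum => i _; apply: rpredZ; rewrite dhomogX.
  by apply/eqP; exact: mdeg1.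
by have := dhomogMn (mm j) hq; rewrite mul1n.
Qed.

End CompLin.

Section Hessian.
Variables (R : realType) (n : nat).
Implicit Types (p : {mpoly R[n]}) (x u v : 'rV[R]_n).

Lemma bform_hessian p x u v :
  bform (hessian p x) u v = (nabla u (nabla v p)).@[x 0].
Proof.
have -> : nabla u (nabla v p) = \sum_i \sum_j (u 0 j * v 0 i) *: p^`M(i)^`M(j).
  rewrite exchange_big {1}/nabla; apply: eq_bigr => j _.
  rewrite [(nabla v p)^`M(j)]linear_sum scaler_sumr; apply: eq_bigr => i _.
  by rewrite /= mderivZ scalerA.
rewrite bformE linear_sum; apply: eq_bigr => i _; rewrite linear_sum.
rewrite mxE mulr_suml; apply: eq_bigr => j _.
by rewrite linearZ /= mxE mderiv_comm; ring.
Qed.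

Lemma mulmx_hessian p x u i :
  (u *m hessian p x) 0 i = (nabla (delta_mx 0 i) (nabla u p)).@[x 0].
Proof. by rewrite nabla_comm -bform_hessian /bform trmx_delta -colE !mxE. Qed.

Lemma hessianE p x i j :
  hessian p x i j = (nabla (delta_mx 0 i) (nabla (delta_mx 0 j) p)).@[x 0].
Proof. by rewrite !nabla_delta mxE mderiv_comm. Qed.

Lemma hessian_sym p x : (hessian p x)^T = hessian p x.
Proof. by apply/matrixP => i j; rewrite !mxE mderiv_comm. Qed.

End Hessian.

(** * Coordinates indexed by vertices *)

Section Coordinates.
Variables (R : realType) (V : finType) (A : {set V}).
Implicit Types (u v : 'rV[R]_#|A|).

(** Indexed by a vertex without a membership proof; it is zero when [F] lies outside [A]. *)
Definition delta_at (F : V) : 'rV[R]_#|A| := \row_i (enum_val i == F)%:R.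

Lemma coord_at_enum v i : coord_at v (enum_val i) = v 0 i.
Proof.
rewrite /coord_at (eq_bigl (pred1 i)) ?big_pred1_eq // => j.
by rewrite /= (inj_eq enum_val_inj).
Qed.

Lemma coord_at_inj u v : {in A, forall F, coord_at u F = coord_at v F} -> u = v.
Proof.
move=> uv; apply/rowP => i; rewrite -[LHS]coord_at_enum -[RHS]coord_at_enum.
by rewrite uv ?enum_valP.
Qed.

Lemma sum_coord_at v F : coord_at v F = \sum_i v 0 i * (enum_val i == F)%:R.
Proof.
rewrite /coord_at big_mkcond; apply: eq_bigr => i _.
by case: eqP; rewrite ?mulr1 ?mulr0.
Qed.

Lemma coord_at_delta (l : 'I_#|A|) F :
  coord_at (delta_mx 0 l : 'rV[R]_#|A|) F = (enum_val l == F)%:R.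
Proof.
rewrite sum_coord_at (bigD1 l) //= big1 => [|i il].
  by rewrite mxE !eqxx mul1r addr0.
by rewrite mxE (negbTE il) andbF mul0r.
Qed.

Lemma coord_at_delta_at F G : G \in A ->
  coord_at (delta_at F) G = (G == F)%:R.
Proof.
by move=> GA; rewrite -(enum_rankK_in GA GA) coord_at_enum mxE.
Qed.

End Coordinates.
Arguments delta_at {R V A}.

(** * Links, vertices and facets *)

Section Complex.
Variables (V : finType) (X : {set {set V}}).
Hypothesis simX : simplicial_complex X.

Lemma mem_link s t : (t \in link X s) = [disjoint s & t] && (s :|: t \in X).
Proof.
apply/imsetP/andP => [[r]|[dst stX]].
  rewrite inE => /andP[rX sr] ->; split.
    by rewrite -setI_eq0; apply/eqP/setP => F; rewrite !inE; case: (F \in s).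
  by rewrite (_ : s :|: r :\: s = r) // -{2}(setID r s) (setIidPr sr).
exists (s :|: t); first by rewrite inE stX subsetUl.
rewrite setDUl setDv set0U; apply/esym/setDidPl.
by rewrite disjoint_sym.
Qed.

Lemma lverts_link s F : (F \in lverts X s) = ([set F] \in link X s).
Proof. by rewrite mem_link inE disjoint_sym disjoints1. Qed.

Lemma lverts_face s F : F \in lverts X s -> s :|: [set F] \in X.
Proof. by rewrite inE => /andP[]. Qed.

Lemma linkU s t w : t \in link X s -> w \in link X (s :|: t) ->
  t :|: w \in link X s.
Proof.
rewrite !mem_link -setUA => /andP[dst _] /andP[dstw ->]; rewrite andbT.
move: dst dstw; rewrite -!setI_eq0 setIUl setIUr !setU_eq0.
by move=> -> /andP[-> _].
Qed.

Lemma lverts_pair s F G : (F \in lverts X s) && (G \in lverts X (s :|: [set F]))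
  = [&& F != G, F \notin s, G \notin s & s :|: [set F; G] \in X].
Proof.
rewrite !inE !negb_or -setUA; apply/andP/and4P.
  by case=> /andP[-> _] /andP[/andP[-> GF] ->]; rewrite eq_sym GF.
case=> FG -> -> FGX; rewrite eq_sym FG FGX; split=> //.
by apply: simX.2 FGX _; apply/setUS; rewrite subsetUl.
Qed.

(** Both sides say that [F] and [G] span an edge of the link. This justifies exchanging double sums
    over vertices. *)
Lemma lverts_pairC s F G :
  (F \in lverts X s) && (G \in lverts X (s :|: [set F])) =
  (G \in lverts X s) && (F \in lverts X (s :|: [set G])).
Proof.
rewrite !lverts_pair eq_sym [ [set G; F] ]setUC.
by case: (F \notin s); case: (G \notin s).
Qed.

Lemma lverts_swap s F G : F \in lverts X s -> G \in lverts X (s :|: [set F]) ->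
  G \in lverts X s /\ F \in lverts X (s :|: [set G]).
Proof. by move=> Fs GsF; apply/andP; rewrite lverts_pairC Fs. Qed.

Lemma link_edge_pair s F G : link_edge X s F G ->
  (F \in lverts X s) && (G \in lverts X (s :|: [set F])).
Proof.
rewrite /link_edge inE mem_link lverts_pair => /andP[/andP[dFG ->]].
rewrite cards2; case: (F != G) => //= _.
move: dFG; rewrite -setI_eq0 setIUr setU_eq0 !setI_eq0.
by rewrite ![ [disjoint s & _] ]disjoint_sym !disjoints1 andbT.
Qed.

Variable d : nat.
Hypothesis pureX : pure X d.

Lemma face_card s : s \in X -> (#|s| <= d)%N.
Proof.
move=> sX; have [t tmax st] := @maxset_exists _ (fun u => u \in X) s sX.
by rewrite -(pureX tmax) subset_leq_card.
Qed.

Lemma lverts_nonempty s : s \in X -> (#|s| < d)%N -> exists F, F \in lverts X s.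
Proof.
move=> sX lt_sd; have [t tmax st] := @maxset_exists _ (fun u => u \in X) s sX.
have : (#|s| < #|t|)%N by rewrite (pureX tmax).
rewrite ltnNge => /negP lt_st.
have /subsetPn[F Ft Fs] : ~~ (t \subset s).
  by apply/negP => /subset_leq_card.
exists F; rewrite inE Fs; apply: simX.2 (maxsetp tmax) _.
by rewrite subUset st sub1set.
Qed.

Lemma card_lverts s F : F \in lverts X s -> #|s :|: [set F]| = #|s|.+1.
Proof. by rewrite inE => /andP[Fs _]; rewrite setUC cardsU1 Fs. Qed.

End Complex.

(** * Families of maps on a simplicial complex *)

Section Family.
Variables (R : realType) (V : finType) (X : {set {set V}}) (mu : {set V} -> R).
Variable pi : map_family R X.
Hypotheses (simX : simplicial_complex X) (famP : is_map_family pi).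
Hypothesis commP : commutative_family pi.

Local Notation n_ s := #|lverts X s|.
Local Notation p_ := (assoc_poly_rec mu pi).
Local Notation "s '+v' F" := (s :|: [set F]) (at level 50).

(** Minus the single coefficient of the functional attached to [[set F]] at the vertex [G]. *)
Definition slope (s : {set V}) (F G : V) : R :=
  coord_at (pi s [set F] (delta_at F)) G.

Lemma coord_pi1 s F G (x : 'rV[R]_(n_ s)) : s \in X -> F \in lverts X s ->
  G \in lverts X (s +v F) ->
  coord_at (pi s [set F] x) G = coord_at x G + slope s F G * coord_at x F.
Proof.
move=> sX Fs GsF.
have Fl : [set F] \in link X s by rewrite -lverts_link.
have [L LP] := famP sX Fl GsF.
have [Gs _] := lverts_swap simX Fs GsF.
have FG : G == F = false.
  by apply/eqP => GF; move: GsF; rewrite GF !inE eqxx orbT.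
have Lc (y : 'rV[R]_(n_ s)) :
    L (subvect [set F] y) = coord_at y F * L (const_mx 1).
  rewrite -[RHS]linearZ; congr (L _); apply/rowP => i; rewrite !mxE mulr1.
  by have /set1P -> := enum_valP i.
rewrite /slope !LP !Lc !coord_at_delta_at // FG eqxx.
by rewrite sub0r mul1r mulNr mulrC.
Qed.

(** Indexing variables by vertices rather than ordinals makes variables of different links
    comparable. *)
Definition var_at (s : {set V}) (F : V) : {mpoly R[n_ s]} :=
  \sum_(l < n_ s | enum_val l == F) 'X_l.

Lemma var_at_enum s i : var_at s (enum_val i) = 'X_i.
Proof.
rewrite /var_at (eq_bigl (pred1 i)) ?big_pred1_eq // => j.
by rewrite /= (inj_eq enum_val_inj).
Qed.

Lemma sum_var_at s F :
  var_at s F = \sum_(l < n_ s) (enum_val l == F)%:R *: 'X_l.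
Proof.
rewrite /var_at big_mkcond; apply: eq_bigr => l _.
by case: eqP; rewrite ?scale1r ?scale0r.
Qed.

Lemma comp_pi1_var_at s F G : s \in X -> F \in lverts X s ->
  G \in lverts X (s +v F) ->
  comp_lin (pi s [set F]) (var_at (s +v F) G) =
  var_at s G + slope s F G *: var_at s F.
Proof.
move=> sX Fs GsF; rewrite -{1}(enum_rankK_in GsF GsF) var_at_enum comp_linX.
rewrite !sum_var_at scaler_sumr -big_split; apply: eq_bigr => l _ /=.
rewrite -coord_at_enum enum_rankK_in // coord_pi1 // !coord_at_delta.
by rewrite scalerDl scalerA.
Qed.

(** Polynomials at equal but non-convertible faces have different types; they are compared after
    pulling back to a common space. *)
Lemma comp_lin_assoc_eq n k s1 s2 (f1 : {linear 'rV[R]_n -> 'rV[R]_(n_ s1)})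
    (f2 : {linear 'rV[R]_n -> 'rV[R]_(n_ s2)}) : s1 = s2 ->
  (forall x H, H \in lverts X s1 -> coord_at (f1 x) H = coord_at (f2 x) H) ->
  comp_lin f1 (p_ k s1) = comp_lin f2 (p_ k s2).
Proof.
move=> eq_s; subst s2 => f12; rewrite /comp_lin; congr (_ \mPo _).
apply: eq_from_tnth => j; rewrite !tnth_mktuple; apply: eq_bigr => i _.
by rewrite !mxE -[f1 _]/(f1 _) (coord_at_inj (f12 _)).
Qed.

(** By commutativity both sides are the pullback along the map that adds [F] and [G] at once. *)
Lemma comp_pi1C k s F G : s \in X -> F \in lverts X s ->
  G \in lverts X (s +v F) ->
  comp_lin (pi s [set F])
    (comp_lin (pi (s +v F) [set G]) (p_ k (s +v F +v G))) =
  comp_lin (pi s [set G])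
    (comp_lin (pi (s +v G) [set F]) (p_ k (s +v G +v F))).
Proof.
move=> sX Fs GsF.
have [Gs FsG] := lverts_swap simX Fs GsF.
rewrite (@comp_lin_comp _ _ _ _ _ _ (pi (s +v F) [set G] \o pi s [set F])) //.
rewrite (@comp_lin_comp _ _ _ _ _ _ (pi (s +v G) [set F] \o pi s [set G])) //.
apply: comp_lin_assoc_eq => [|x H HFG].
  by rewrite -!setUA [ [set F; G] ]setUC.
rewrite /= -commP -?lverts_link ?setUA //.
by rewrite -commP -?lverts_link ?setUA // -?setUA [ [set G] :|: _]setUC // setUA.
Qed.

Lemma assoc_poly_recS k s : k.+1%:R *: p_ k.+1 s =
  \sum_(F in lverts X s) var_at s F * comp_lin (pi s [set F]) (p_ k (s +v F)).
Proof.
rewrite /= scalerA divff ?pnatr_eq0 // scale1r [RHS]big_enum_val /=.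
by apply: eq_bigr => i _; rewrite var_at_enum.
Qed.

Lemma nabla_var_at s v F : nabla v (var_at s F) = (coord_at v F)%:MP.
Proof.
by rewrite linear_sum raddf_sum; apply: eq_bigr => l _; exact: nablaX.
Qed.

(** By the product rule, k + 1 times the derivative is the claimed sum plus the left-hand side of
    the hypothesis. *)
Lemma nabla_assoc_poly_of_euler k s v :
  \sum_(F in lverts X s)
    var_at s F * nabla v (comp_lin (pi s [set F]) (p_ k (s +v F))) =
  k%:R *: \sum_(F in lverts X s)
    coord_at v F *: comp_lin (pi s [set F]) (p_ k (s +v F)) ->
  nabla v (p_ k.+1 s) = \sum_(F in lverts X s)
    coord_at v F *: comp_lin (pi s [set F]) (p_ k (s +v F)).
Proof.
move=> key; apply: (@scalerI _ _ k.+1%:R); first by rewrite pnatr_eq0.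
rewrite -linearZ assoc_poly_recS linear_sum -natr1 scalerDl scale1r -key.
rewrite -big_split; apply: eq_bigr => F _ /=.
by rewrite nablaM nabla_var_at mul_mpolyC addrC.
Qed.

(* Euler's identity reduces the claim to the symmetry of the second derivatives,
   which is commutativity of the family. *)
Lemma nabla_assoc_poly k s v : s \in X ->
  nabla v (p_ k.+1 s) = \sum_(F in lverts X s)
    coord_at v F *: comp_lin (pi s [set F]) (p_ k (s +v F)).
Proof.
elim: k s v => [|k IHk] s v sX.
  apply: nabla_assoc_poly_of_euler; rewrite scale0r big1 // => F _.
  by rewrite comp_linC nablaC mulr0.
apply: nabla_assoc_poly_of_euler.
(* The mixed second derivative, symmetric in [F] and [G] by [comp_pi1C]. *)
pose N F G := comp_lin (pi s [set F])
  (comp_lin (pi (s +v F) [set G]) (p_ k (s +v F +v G))).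
rewrite scaler_sumr.
transitivity (\sum_(F in lverts X s) \sum_(G in lverts X (s +v F))
    (coord_at v G *: (var_at s F * N F G) +
     (slope s F G * coord_at v F) *: (var_at s F * N F G))).
  apply: eq_bigr => F Fs; rewrite nabla_comp_lin IHk ?lverts_face //.
  rewrite linear_sum mulr_sumr; apply: eq_bigr => G GsF.
  by rewrite linearZ /= coord_pi1 // -scalerDl scalerAr.
transitivity (\sum_(F in lverts X s) \sum_(G in lverts X (s +v F))
    (coord_at v F *: (var_at s G * N F G) +
     (slope s F G * coord_at v F) *: (var_at s F * N F G))); last first.
  apply: eq_bigr => F Fs; rewrite scalerA mulrC -scalerA.
  have -> : k.+1%:R *: comp_lin (pi s [set F]) (p_ k.+1 (s +v F)) =
      comp_lin (pi s [set F]) (k.+1%:R *: p_ k.+1 (s +v F)).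
    by rewrite (linearZ _ (p_ k.+1 _)).
  rewrite assoc_poly_recS [comp_lin _ _]linear_sum scaler_sumr.
  apply: eq_bigr => G GsF /=.
  rewrite comp_linM comp_pi1_var_at // mulrDl scalerDr -scalerAl.
  by rewrite scalerA [slope _ _ _ * _]mulrC.
(* The slope terms coincide; the others match after exchanging [F] and [G]. *)
rewrite !(eq_bigr _ (fun F _ => big_split _ _ _ _ _)) !big_split; congr (_ + _).
rewrite (exchange_big_dep (mem (lverts X s))) /=; last first.
  by move=> F G Fs /(lverts_swap simX Fs)[].
apply: eq_bigr => G Gs; apply: eq_big => [F|F /andP[Fs GsF]].
  by rewrite lverts_pairC // Gs.
by rewrite /N comp_pi1C.
Qed.

End Family.

(** * The cones of the family *)

Section Cone.
Variables (R : realType) (V : finType) (X : {set {set V}}).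
Variable pi : map_family R X.

Lemma linear_coord_continuous n m (f : {linear 'rV[R]_n -> 'rV[R]_m}) j :
  continuous (fun v : 'rV[R]_n => f v 0 j).
Proof.
have -> : (fun v : 'rV[R]_n => f v 0 j) =
    (fun v => \sum_i v 0 i * f (delta_mx 0 i) 0 j).
  by apply: boolp.funext => v; rewrite linear_row.
apply: continuous_big => [x|i _]; first exact: add_continuous.
move=> v; apply: cvgMr_tmp; first exact: nbhs_filter.
exact: (@coord_continuous R 1 n 0 i v).
Qed.

(** The cone is cut out by finitely many strict linear inequalities. *)
Lemma assoc_cone_open s : open (assoc_cone pi s).
Proof.
have pos_near n m (f : {linear 'rV[R]_n -> 'rV[R]_m}) v j : 0 < f v 0 j ->
    nbhs v (fun u => 0 < f u 0 j).
  move=> fv; have := @linear_coord_continuous _ _ f j v.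
  by move=> /cvgr_gt; apply.
rewrite openE => v [v_gt0 piv_gt0].
have near_all (I : finType) (f : I -> 'rV[R]_#|lverts X s| -> Prop) :
    (forall i, nbhs v (f i)) -> nbhs v (fun u => forall i, f i u).
  exact: (filter_forall (nbhs_filter v)).
apply: (@filterI _ _ (nbhs_filter v)).
  by apply: (near_all) => i; exact: (pos_near _ _ (idfun : {linear _ -> _})).
apply: (near_all) => t; have [tl|tl] := boolP (t \in link X s).
  have := near_all _ _ (fun j => pos_near _ _ (pi s t) v j (piv_gt0 t tl j)).
  by apply: (@filterS _ _ (nbhs_filter v)) => u.
by apply: (@filterE _ _ (nbhs_filter v)) => u.
Qed.

Lemma assoc_cone_scale s a v : 0 < a ->
  assoc_cone pi s v -> assoc_cone pi s (a *: v).
Proof.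
move=> a0 [v0 piv]; split=> [i|t tl j]; first by rewrite mxE mulr_gt0.
by rewrite linearZ mxE mulr_gt0 // piv.
Qed.

Lemma assoc_cone_add s u v :
  assoc_cone pi s u -> assoc_cone pi s v -> assoc_cone pi s (u + v).
Proof.
move=> [u0 piu] [v0 piv]; split=> [i|t tl j]; first by rewrite mxE addr_gt0.
by rewrite linearD mxE addr_gt0 ?piu ?piv.
Qed.

Lemma assoc_cone_open_convex s : open_convex_cone (assoc_cone pi s).
Proof.
split; [exact: assoc_cone_open| |by move=> a v; exact: assoc_cone_scale].
apply/convex_setW => u v /set_mem Cu /set_mem Cv k k0 k1; apply/mem_set.
apply: assoc_cone_add; apply: assoc_cone_scale => //.
by rewrite subr_gt0.
Qed.

Hypothesis commP : commutative_family pi.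

Lemma coord_cone s v F : assoc_cone pi s v -> F \in lverts X s ->
  0 < coord_at v F.
Proof. by move=> [v0 _] Fs; rewrite -(enum_rankK_in Fs Fs) coord_at_enum. Qed.

(** Commutativity turns each condition at the larger face into one already imposed at [s]. *)
Lemma assoc_cone_pi s t v : s \in X -> t \in link X s ->
  assoc_cone pi s v -> assoc_cone pi (s :|: t) (pi s t v).
Proof.
move=> sX tl Cv; split=> [|w wl j]; first by case: Cv => _; exact.
rewrite -coord_at_enum -commP //; last by rewrite setUA enum_valP.
have Hl : enum_val j \in lverts X (s :|: (t :|: w)) by rewrite setUA enum_valP.
rewrite -(enum_rankK_in Hl Hl) coord_at_enum; case: Cv => _; apply.
exact: linkU.
Qed.

End Cone.

(** * Polar forms *)

Section Polar.
Variables (R : realType) (V : finType) (X : {set {set V}}) (d : nat).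
Variables (mu : {set V} -> R) (pi : map_family R X).
Hypotheses (simX : simplicial_complex X) (pureX : pure X d).
Hypothesis muP : positive_distribution X d mu.
Hypotheses (famP : is_map_family pi) (commP : commutative_family pi).

Local Notation n_ s := #|lverts X s|.
Local Notation p_ := (assoc_poly_rec mu pi).
Local Notation "s '+v' F" := (s :|: [set F]) (at level 50).

(** For [vs] of size [k] this is k! times the polarization of the polynomial, whatever the point
    [x]. *)
Definition polar k s (x : 'rV[R]_(n_ s)) (vs : seq 'rV[R]_(n_ s)) : R :=
  (nablas vs (p_ k s)).@[x 0].

(** Derivatives commute, so [v] can act first on the polynomial and move the remaining ones to the
    links. *)
Lemma polar_cons k s x v vs : s \in X ->
  polar k.+1 x (v :: vs) = \sum_(F in lverts X s)
    coord_at v F * polar k (pi s [set F] x) (map (pi s [set F]) vs).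
Proof.
move=> sX; rewrite /polar [nablas _ _]/= -nablas_nabla nabla_assoc_poly //.
rewrite linear_sum raddf_sum; apply: eq_bigr => F _ /=.
by rewrite linearZ /= mevalZ nablas_comp_lin eval_comp_lin.
Qed.

Lemma polar_delta k s x i vs : s \in X ->
  polar k.+1 x (delta_mx 0 i :: vs) =
  polar k (pi s [set enum_val i] x) (map (pi s [set enum_val i]) vs).
Proof.
move=> sX; rewrite polar_cons // (bigD1 (enum_val i)) ?enum_valP //=.
rewrite big1 => [|F].
  by rewrite coord_at_delta eqxx mul1r addr0.
by case/andP=> _ Fi; rewrite coord_at_delta eq_sym (negbTE Fi) mul0r.
Qed.

Lemma assoc_cone_pi1 s F vs : s \in X -> F \in lverts X s ->
  (forall v, v \in vs -> assoc_cone pi s v) ->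
  forall v, v \in map (pi s [set F]) vs -> assoc_cone pi (s +v F) v.
Proof.
move=> sX Fs Cvs _ /mapP[v vvs ->]; apply: assoc_cone_pi => //; last exact: Cvs.
by rewrite -lverts_link.
Qed.

(** Induction through [polar_cons]: the weights are positive, the cones map to cones, and a face
    that is not a facet has a vertex in its link. The base case is positivity of [mu]. *)
Lemma polar_gt0 k s x vs : s \in X -> (#|s| + k)%N = d -> size vs = k ->
  (forall v, v \in vs -> assoc_cone pi s v) -> 0 < polar k x vs.
Proof.
elim: k s x vs => [|k IHk] s x [|v vs] //= sX sd.
  by move=> _ _; rewrite /polar mevalC muP.1 // inE sX -sd addn0 eqxx.
move=> [sz] Cvs.
have [F0 F0s] : exists F, F \in lverts X s.
  by apply: (lverts_nonempty simX pureX) => //; rewrite -sd addnS ltnS leq_addr.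
have pos F : F \in lverts X s -> 0 < coord_at v F *
    polar k (pi s [set F] x) (map (pi s [set F]) vs).
  move=> Fs; apply: mulr_gt0.
    by apply: coord_cone Fs; apply: Cvs; rewrite mem_head.
  apply: IHk; rewrite ?size_map ?lverts_face ?(card_lverts Fs) ?addSnnS //.
  by apply: assoc_cone_pi1 => // u uvs; apply: Cvs; rewrite inE uvs orbT.
rewrite polar_cons // (bigD1 F0) //= ltr_wpDr ?pos //.
by apply: sumr_ge0 => F /andP[Fs _]; rewrite ltW // pos.
Qed.

(** The correction term reads only the coordinate of the added vertex, which vanishes on the other
    basis vectors. *)
Lemma coord_pi1_delta s i H : s \in X -> H \in lverts X (s +v enum_val i) ->
  forall j : 'I_(n_ s), i != j ->
  coord_at (pi s [set enum_val i] (delta_mx 0 j)) H = (enum_val j == H)%:R.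
Proof.
move=> sX Hsi j ij; rewrite coord_pi1 ?enum_valP // !coord_at_delta.
by rewrite (inj_eq enum_val_inj) [j == i]eq_sym (negbTE ij) mulr0 addr0.
Qed.

(** These are the off-diagonal Hessian entries. In the link of vertex [i] the basis vector of [j]
    keeps its 0-1 coordinates, which weight positive polar forms. *)
Lemma polar_delta2_ge0 k s x i j vs : s \in X -> (#|s| + k.+2)%N = d ->
  size vs = k -> (forall v, v \in vs -> assoc_cone pi s v) -> i != j ->
  0 <= polar k.+2 x (delta_mx 0 i :: delta_mx 0 j :: vs) /\
  (enum_val j \in lverts X (s +v enum_val i) ->
   0 < polar k.+2 x (delta_mx 0 i :: delta_mx 0 j :: vs)).
Proof.
move=> sX sd sz Cvs ij; rewrite polar_delta //=; set F := enum_val i.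
have Fs : F \in lverts X s := enum_valP i.
rewrite polar_cons ?lverts_face //.
set f := BIG_F.
have polar2_gt0 H : H \in lverts X (s +v F) ->
    0 < polar k (pi (s +v F) [set H] (pi s [set F] x))
          (map (pi (s +v F) [set H]) (map (pi s [set F]) vs)).
  move=> HsF; have sFX := lverts_face Fs.
  apply: polar_gt0; first exact: lverts_face.
  - by rewrite (card_lverts HsF) (card_lverts Fs) !addSnnS.
  - by rewrite !size_map.
  - by apply: assoc_cone_pi1 => //; exact: assoc_cone_pi1.
have f_ge0 H : H \in lverts X (s +v F) -> 0 <= f H.
  move=> HsF; rewrite /f coord_pi1_delta // mulr_ge0 // ltW //.
  exact: polar2_gt0.
split=> [|GsF]; first exact: sumr_ge0.
rewrite (bigD1 (enum_val j)) //= ltr_wpDr //.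
  by apply: sumr_ge0 => H /andP[/f_ge0].
rewrite /f coord_pi1_delta // eqxx mul1r.
exact: polar2_gt0.
Qed.

Lemma assoc_poly_homog k s : p_ k s \is k.-homog.
Proof.
elim: k s => [|k IHk] s; first by rewrite /= -alg_mpolyC rpredZ ?dhomog1.
rewrite [p_ _ _]/=; apply/rpredZ/rpred_sum => i _.
by rewrite -add1n dhomogM ?comp_lin_homog // dhomogX; apply/eqP/mdeg1.
Qed.

(** * Reverse Cauchy-Schwarz by induction on the codimension *)

Hypothesis connX : connected_complex X d.
Hypothesis hess2 : forall s : {set V}, s \in X -> #|s|.+2 = d ->
  forall x : 'rV[R]_(n_ s),
    at_most_one_pos_eigenvalue (hessian (assoc_poly d mu pi s) x).

(** The base case is the hypothesis in codimension two. In the inductive step the head [w] of [vs]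
    is the witness, and the links of vertices supply A <= A D A. *)
Lemma reverse_cauchy_schwarz_hessian k s x vs : s \in X ->
  (#|s| + k.+2)%N = d -> size vs = k ->
  (forall v, v \in vs -> assoc_cone pi s v) ->
  reverse_cauchy_schwarz (hessian (nablas vs (p_ k.+2 s)) x).
Proof.
elim: k s x vs => [|k IHk] s x [|w vs] // sX sd sz Cvs.
  apply/(reverse_cauchy_schwarzP (hessian_sym _ _)).
  have := @hess2 s sX; rewrite /assoc_poly -{1 2}sd addKn; apply.
  by rewrite addn2.
case: sz => sz; set A := hessian _ x.
have sA : A^T = A by exact: hessian_sym.
have AE u v : bform A u v = polar k.+3 x (u :: v :: w :: vs).
  exact: bform_hessian.
have Cw : assoc_cone pi s w by apply: Cvs; rewrite mem_head.
have Cvs' v : v \in vs -> assoc_cone pi s v.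
  by move=> vvs; apply: Cvs; rewrite inE vvs orbT.
pose F_ i : V := enum_val (i : 'I_(n_ s)).
have F_s i : F_ i \in lverts X s by exact: enum_valP.
have card_F i : (#|s +v F_ i| + k.+2)%N = d.
  by rewrite (card_lverts (F_s i)) addSnnS.
have mulA u i : (u *m A) 0 i = polar k.+2 (pi s [set F_ i] x)
    (map (pi s [set F_ i]) [:: u, w & vs]).
  by rewrite mulmx_hessian -polar_delta.
have polar_F i us : size us = k.+2 ->
    (forall v, v \in us -> assoc_cone pi s v) ->
    0 < polar k.+2 (pi s [set F_ i] x) (map (pi s [set F_ i]) us).
  move=> sus Cus; apply: polar_gt0; rewrite ?size_map ?lverts_face //.
  exact: assoc_cone_pi1.
have wA i : 0 < (w *m A) 0 i.
  by rewrite mulA polar_F //= ?sz // => v; rewrite inE => /predU1P[->|/Cvs].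
have A_off i j : i != j -> 0 <= A i j /\
    (F_ j \in lverts X (s +v F_ i) -> 0 < A i j).
  move=> ij; rewrite /A hessianE.
  by apply: (@polar_delta2_ge0 k.+1 s x i j (w :: vs)); rewrite //= sz.
apply: (@reverse_cauchy_schwarz_of_witness _ _ _ w) => //.
  rewrite AE polar_gt0 //= ?sz // => v.
  by rewrite !inE => /or3P[/eqP->|/eqP->|/predU1P[->|/Cvs']].
apply: bform_le0_perron => //.
- by move=> i j /A_off[].
- by case: Cw.
- move=> f fA i j.
  (* Transports [f] to vertices, so that it can be followed along a path in the link; off the link
     it takes the default value [f i]. *)
  pose g H := f (enum_rank_in (F_s i) H).
  have gF l : g (F_ l) = f l by rewrite /g enum_valK_in.
  suff gE F G : connect (link_edge X s) F G -> g F = g G.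
    rewrite -[f i]gF -[f j]gF; apply: gE; apply: connX => //.
    by rewrite -sd -addn2 leq_add2l.
  case/connectP=> p; elim: p F => [F _ -> //|H p IHp F /= /andP[FH Hp] Gp].
  rewrite -(IHp H) // /g; have /andP[Fs HsF] := link_edge_pair simX FH.
  have [Hs _] := lverts_swap simX Fs HsF.
  apply: fA.
    apply/eqP => /(congr1 enum_val); rewrite !enum_rankK_in // => eqFH.
    by move: HsF; rewrite eqFH !inE eqxx orbT.
  apply: (A_off _ _ _).2; last by rewrite /F_ !enum_rankK_in.
  apply/eqP => /(congr1 enum_val); rewrite !enum_rankK_in // => eqFH.
  by move: HsF; rewrite eqFH !inE eqxx orbT.
(* Moving the copy of [w] contained in [A] to the front expands the form over the vertices with
   weights w_F. *)
move=> z; have -> : bform A z z = polar k.+3 x [:: w, z, z & vs].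
  by rewrite AE /polar /= [nabla z (nabla w _)]nabla_comm nabla_comm.
rewrite polar_cons // big_enum_val /=; apply: ler_sum => i _.
rewrite coord_at_enum ler_wpM2l //; first by case: Cw => /(_ i)/ltW.
(* The inequality in the link for the images of [z] and [w], where the values at (w, w) and (z, w)
   are the entries of w A and z A. *)
have := IHk (s +v F_ i) (pi s [set F_ i] x) (map (pi s [set F_ i]) vs).
have CFvs := assoc_cone_pi1 sX (F_s i) Cvs'.
rewrite lverts_face // size_map => /(_ isT (card_F i) sz CFvs).
move=> /(_ (pi s [set F_ i] z) (pi s [set F_ i] w)).
rewrite !bform_hessian ler_pdivlMr // !mulA; apply.
by have := wA i; rewrite mulA.
Qed.

End Polar.

Theorem mainTheorem10 (R : realType) (V : finType) (X : {set {set V}})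
    (d : nat) (mu : {set V} -> R) (pi : map_family R X) :
  simplicial_complex X ->
  pure X d ->
  positive_distribution X d mu ->
  connected_complex X d ->
  is_map_family pi ->
  commutative_family pi ->
  (exists v, assoc_cone pi set0 v) ->
  (forall s : {set V}, s \in X -> #|s|.+2 = d ->
     forall x : 'rV[R]_#|lverts X s|,
       at_most_one_pos_eigenvalue (hessian (assoc_poly d mu pi s) x)) ->
  forall s : {set V}, s \in X ->
    lorentzian (d - #|s|)%N (assoc_cone pi s) (assoc_poly d mu pi s).
Proof.
move=> simX pureX muP connX famP commP [v0 Cv0] hess2 s sX.
have sd : (#|s| + (d - #|s|))%N = d by rewrite subnKC // (face_card pureX).
rewrite /assoc_poly; split.
- split; last exact: assoc_cone_open_convex.
  (* The image of [v0] under the map from the empty face to [s] shows that the cone at [s] is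
     non-empty. *)
  have sl : s \in link X set0 by rewrite mem_link // -setI_eq0 set0I eqxx set0U.
  have : exists v, assoc_cone pi (set0 :|: s) v.
    by exists (pi set0 s v0); apply: assoc_cone_pi => //; exact: simX.1.
  by rewrite set0U.
- exact: assoc_poly_homog.
- move=> vs sz Cvs x; exact: (polar_gt0 simX pureX muP famP commP).
move=> vs sz Cvs x; apply/(reverse_cauchy_schwarzP (hessian_sym _ _)).
rewrite -sz; apply: (reverse_cauchy_schwarz_hessian simX pureX muP) => //.
by rewrite sz.
Qed.
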